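(* Let $n\ge1$, and let rows $i$ and $j$ both be vertical strip rows, with spectral parameters $y_i$ and $y_j$. Then the rectangular vertex weights of vertical strip rows together with the $VV$ weights of $R^{(n)}$-vertices satisfy the Yang–Baxter equation: for all boundary labels $a,\alpha\in\{\wedge,\vee\}$ and $b,c,\beta,\gamma\in\{<,>\}^n$, $$\sum_{\boldsymbol I,\boldsymbol J,\delta}\operatorname{wt}\!\big(R(\boldsymbol I,\boldsymbol J,c,b)\big)\,\operatorname{wt}_{i}\!\big(a,\delta;\boldsymbol I,\gamma\big)\,\operatorname{wt}_{j}\!\big(\delta,\alpha;\boldsymbol J,\beta\big)=\sum_{\boldsymbol K,\boldsymbol L,\xi}\operatorname{wt}_{j}\!\big(a,\xi;b,\boldsymbol L\big)\,\operatorname{wt}_{i}\!\big(\xi,\alpha;c,\boldsymbol K\big)\,\operatorname{wt}\!\big(R(\gamma,\beta,\boldsymbol K,\boldsymbol L)\big),$$ where the sums run over $\boldsymbol I,\boldsymbol J,\boldsymbol K,\boldsymbol L\in\{<,>\}^n$ and $\delta,\xi\in\{\wedge,\vee\}$.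
   Context: **Rectangular vertices.** An $n$-ribbon vertex $v$ has labels $v_N,v_S\in\{\wedge,\vee\}$ (arrows up/down) on the vertical edges above and below it, and $n$-tuples $v_W,v_E\in\{<,>\}^n$ (arrows left/right) on its left and right sides, with components $v_W(k),v_E(k)$, $1\le k\le n$, where $k=1$ is the bottom strand and $k=n$ the top strand. It is admissible if the number of arrows pointing in equals the number pointing out and $v_E(k)=v_W(k+1)$ for $1\le k\le n-1$. An admissible vertex has one of six types, given by $(v_N,v_S,v_W(1),v_E(n))$: SW: $(\wedge,\wedge,>,>)$; NS: $(\vee,\wedge,<,>)$; SE: $(\wedge,\wedge,<,<)$; NW: $(\vee,\vee,>,>)$; EW: $(\wedge,\vee,>,<)$; NE: $(\vee,\vee,<,<)$. Let $s$ be the number of left arrows among $v_E(1),\dots,v_E(n-1)$. In a vertical strip row with spectral parameter $y$ the weights are: SW: $q^s$; NS: $1$; SE: $-y$; NW: $1$; EW: $-y$; NE: $0$. Non-admissible vertices have weight $0$. For tuples $P,Q\in\{<,>\}^n$ listed from top to bottom, $\operatorname{wt}_i(N,S;P,Q)$ denotes the weight in row $i$ of the vertex with $v_N=N$, $v_S=S$, $v_W(n+1-k)=P_k$, $v_E(n+1-k)=Q_k$ for $1\le k\le n$; similarly $\operatorname{wt}_j$ for row $j$. **$R^{(n)}$-vertices.** An $R^{(n)}$-vertex $R(\boldsymbol I,\boldsymbol J,\boldsymbol K,\boldsymbol L)$ is a diagonal vertex with label tuples in $\{<,>\}^n$, each listed from top to bottom: $\boldsymbol I$ (upper right), $\boldsymbol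 J$ (lower right), $\boldsymbol K$ (lower left), $\boldsymbol L$ (upper left). The row-$i$ strand joins $\boldsymbol K$ to $\boldsymbol I$ and the row-$j$ strand joins $\boldsymbol L$ to $\boldsymbol J$. It is viewed as $n$ stacked $R^{(1)}$-vertices $r_k=(I_k,J_k,K_k,L_k)$, $1\le k\le n$ ($k=1$ on top), and its weight is $\prod_{k=1}^n\operatorname{wt}(r_k)$. The types of $R^{(1)}$-vertices, given by $(I_k,J_k,K_k,L_k)$, are: N: $(>,<,>,<)$; SS: $(>,<,<,>)$; W: $(<,<,<,<)$; E: $(>,>,>,>)$; NN: $(<,>,>,<)$; S: $(<,>,<,>)$. Any other $R^{(1)}$-vertex has weight $0$. For fixed $k$ let $$\theta'=2\,\#\{t>k:r_t=\mathrm N\},\qquad\sigma'=\#\{t<k:r_t=\mathrm{SS}\}+\#\{t>k:r_t=\mathrm{NN}\}+\#\{t:r_t=\mathrm W\}.$$ The $VV$ weights are: N: $q^{\sigma'}(y_j-q^{\theta'}y_i)$; SS: $y_j$; W: $y_i$; E: $y_j$; NN: $y_i$; S: $0$. *)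

(* Defs.v *)
From HB Require Import structures.
From mathcomp Require Import all_boot all_order all_algebra.
Set Implicit Arguments.
Unset Strict Implicit.
Unset Printing Implicit Defensive.
Import GRing.Theory.
Local Open Scope ring_scope.

Inductive varrow := Up | Down.
Inductive harrow := Left | Right.

Definition bool_of_varrow (x : varrow) : bool := if x is Up then true else false.
Definition varrow_of_bool (b : bool) : varrow := if b then Up else Down.
Lemma bool_of_varrowK : cancel bool_of_varrow varrow_of_bool.
Proof. by case. Qed.
HB.instance Definition _ := Finite.copy varrow (can_type bool_of_varrowK).

Definition bool_of_harrow (x : harrow) : bool := if x is Right then true else false.
Definition harrow_of_bool (b : bool) : harrow := if b then Right else Left.
Lemma bool_of_harrowK : cancel bool_of_harrow harrow_of_bool.
Proof. by case. Qed.
HB.instance Definition _ := Finite.copy harrow (can_type bool_of_harrowK).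

(* The number of strands is n.+1, so that the condition "at least one strand"
   is built in.  Strand indices are 0-based. *)
Notation strands n := {ffun 'I_n.+1 -> harrow}.

(* In a ribbon vertex, index 0 of [vW] and [vE] is the bottom strand and
   [ord_max] the top one. *)
Record ribbon_vertex (n : nat) := RibbonVertex {
  vN : varrow;
  vS : varrow;
  vW : strands n;
  vE : strands n
}.

Definition arrows_in (n : nat) (v : ribbon_vertex n) : nat :=
  ((vN v == Down) + (vS v == Up)
   + #|[set k | vW v k == Right]| + #|[set k | vE v k == Left]|)%N.

Definition arrows_out (n : nat) (v : ribbon_vertex n) : nat :=
  ((vN v == Up) + (vS v == Down)
   + #|[set k | vW v k == Left]| + #|[set k | vE v k == Right]|)%N.

Definition admissible (n : nat) (v : ribbon_vertex n) : bool :=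
  (arrows_in v == arrows_out v) &&
  [forall k : 'I_n.+1, forall l : 'I_n.+1,
     (val l == (val k).+1) ==> (vE v k == vW v l)].

Inductive rect_type := SW | NS | SE | NW | EW | NE.

(* The patterns for which the result is [None] do not occur for admissible
   vertices. *)
Definition type_of_ribbon_vertex (n : nat) (v : ribbon_vertex n) :
    option rect_type :=
  match vN v, vS v, vW v ord0, vE v ord_max with
  | Up,   Up,   Right, Right => Some SW
  | Down, Up,   Left,  Right => Some NS
  | Up,   Up,   Left,  Left  => Some SE
  | Down, Down, Right, Right => Some NW
  | Up,   Down, Right, Left  => Some EW
  | Down, Down, Left,  Left  => Some NE
  | _, _, _, _ => None
  end.

(* Left arrows on the eastern side, the top strand excluded. *)
Definition spin (n : nat) (v : ribbon_vertex n) : nat :=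
  #|[set k : 'I_n.+1 | (k < n)%N && (vE v k == Left)]|.

Definition vstrip_vertex_wt (A : comNzRingType) (q y : A) (n : nat)
    (v : ribbon_vertex n) : A :=
  if admissible v then
    match type_of_ribbon_vertex v with
    | Some SW => q ^+ spin v
    | Some NS => 1
    | Some SE => - y
    | Some NW => 1
    | Some EW => - y
    | Some NE => 0
    | None => 0
    end
  else 0.

(* Here P and Q list the western and eastern labels from top to bottom, hence
   the reversal. *)
Definition vstrip_wt (A : comNzRingType) (q y : A) (n : nat)
    (N S : varrow) (P Q : strands n) : A :=
  vstrip_vertex_wt q y
    (RibbonVertex N S [ffun k => P (rev_ord k)] [ffun k => Q (rev_ord k)]).

Inductive R1_type := R1_N | R1_SS | R1_W | R1_E | R1_NN | R1_S.

Lemma R1_type_comparable : comparable R1_type.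
Proof. by move=> x y; rewrite /decidable; decide equality. Defined.
HB.instance Definition _ := hasDecEq.Build R1_type (compareP R1_type_comparable).

Definition type_of_R1 (i j k l : harrow) : option R1_type :=
  match i, j, k, l with
  | Right, Left,  Right, Left  => Some R1_N
  | Right, Left,  Left,  Right => Some R1_SS
  | Left,  Left,  Left,  Left  => Some R1_W
  | Right, Right, Right, Right => Some R1_E
  | Left,  Right, Right, Left  => Some R1_NN
  | Left,  Right, Left,  Right => Some R1_S
  | _, _, _, _ => None
  end.

(* An R-vertex: upper right, lower right, lower left and upper left labels,
   each listed from top to bottom (index 0 is on top). *)
Record R_vertex (n : nat) := RVertex {
  rI : strands n;
  rJ : strands n;
  rK : strands n;
  rL : strands n
}.

Definition R1_at (n : nat) (v : R_vertex n) (k : 'I_n.+1) : option R1_type :=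
  type_of_R1 (rI v k) (rJ v k) (rK v k) (rL v k).

Definition theta' (n : nat) (v : R_vertex n) (k : 'I_n.+1) : nat :=
  (2 * #|[set t : 'I_n.+1 | (k < t)%N && (R1_at v t == Some R1_N)]|)%N.

Definition sigma' (n : nat) (v : R_vertex n) (k : 'I_n.+1) : nat :=
  (#|[set t : 'I_n.+1 | (t < k)%N && (R1_at v t == Some R1_SS)]|
   + #|[set t : 'I_n.+1 | (k < t)%N && (R1_at v t == Some R1_NN)]|
   + #|[set t : 'I_n.+1 | R1_at v t == Some R1_W]|)%N.

Definition VV_R1_wt (A : comNzRingType) (q yi yj : A) (n : nat)
    (v : R_vertex n) (k : 'I_n.+1) : A :=
  match R1_at v k with
  | Some R1_N => q ^+ sigma' v k * (yj - q ^+ theta' v k * yi)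
  | Some R1_SS => yj
  | Some R1_W => yi
  | Some R1_E => yj
  | Some R1_NN => yi
  | Some R1_S => 0
  | None => 0
  end.

Definition VV_wt (A : comNzRingType) (q yi yj : A) (n : nat)
    (v : R_vertex n) : A :=
  \prod_(k < n.+1) VV_R1_wt q yi yj v k.

(* Main.v *)
Require Import Defs.
From mathcomp Require Import all_boot all_order all_algebra.
From mathcomp Require Import zify ring.

(** In an admissible ribbon vertex the arrows are shifted by one strand: from
    top to bottom, the eastern labels are a new top label followed by all the
    western labels but the bottom one ([vstrip_wtE]).  So in a nonzero term on
    the left of the equation, [I] and [J] are [gamma] and [beta] moved up by
    one strand, with free bottom labels; on the right, [K] and [L] are [c] and
    [b] moved down by one strand, with free top labels.  Hence the R-vertices
    of both sides contain the same stack [M] of R1-vertices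
    ([middle_stack]): on the left one more vertex is added below [M], on the
    right one is added above it.

    It remains to compare the weights of the two extensions with the weight of
    [M] itself.  Adding a vertex at either end multiplies the weight of [M] by
    a factor that depends only on the new vertex and on the numbers of
    vertices of each type in [M].  At the top this is immediate, because the
    exponents theta' only look downwards.  At the bottom a new vertex of type
    N raises the exponent theta' of every N of [M] by 2, and the product of
    the y_j - q^(theta') y_i telescopes: the total effect is one new factor
    y_j - q^(2m) y_i, with m the number of N's in [M], which is the factor
    that a new N on top would bring ([stack_wt_rcons]).

    When the weight of [M] is nonzero, the numbers of left arrows that enter
    the SW weights are sums of the same type counts ([count_left]), so that
    after removing the weight of [M] only a Yang-Baxter equation with one
    strand is left, in which the powers of q are independent indeterminates.
    It consists of 64 polynomial identities ([one_strand_YBE]). *)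

Set Implicit Arguments.
Unset Strict Implicit.
Unset Printing Implicit Defensive.
Import GRing.Theory.
Local Open Scope ring_scope.

(** * Sums and counts over arrows and strands *)

Local Notation widen := (widen_ord (leqnSn _)).

Lemma big_harrow (V : nmodType) (F : harrow -> V) :
  \sum_x F x = F Left + F Right.
Proof. by rewrite (bigD1 Left) //= (bigD1 Right) //= big1 ?addr0 //; case. Qed.

Lemma big_varrow (V : nmodType) (F : varrow -> V) :
  \sum_x F x = F Up + F Down.
Proof. by rewrite (bigD1 Up) //= (bigD1 Down) //= big1 ?addr0 //; case. Qed.

Lemma card_ord_count n (P : pred 'I_n) :
  #|[set k | P k]| = count P (enum 'I_n).
Proof. by rewrite cardsE cardE enumT -size_filter. Qed.

Lemma card_ord_rev n (P : pred 'I_n) :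
  #|[set k | P (rev_ord k)]| = #|[set k | P k]|.
Proof.
rewrite -(card_imset _ (@rev_ord_inj n)); apply: eq_card => k.
rewrite inE -[k in LHS]rev_ordK mem_imset ?inE ?rev_ordK //; exact: rev_ord_inj.
Qed.

Lemma count_enum_recl n (P : pred 'I_n.+1) :
  count P (enum 'I_n.+1) = (P ord0 + count (P \o lift ord0) (enum 'I_n))%N.
Proof. by rewrite enum_ordSl /= count_map. Qed.

Lemma count_enum_recr n (P : pred 'I_n.+1) :
  count P (enum 'I_n.+1) = (count (P \o widen) (enum 'I_n) + P ord_max)%N.
Proof. by rewrite enum_ordSr -cats1 count_cat count_map /= addn0. Qed.

(** * Vertical strip vertices as shifts *)

(** The power [q ^+ s] is replaced by an arbitrary element [qs]; [p] is the
    bottom western label and [x] the top eastern one. *)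
Definition rect_wt (A : comNzRingType) (qs y : A) (N S : varrow)
    (p x : harrow) : A :=
  match N, S, p, x with
  | Up,   Up,   Right, Right => qs
  | Down, Up,   Left,  Right => 1
  | Up,   Up,   Left,  Left  => - y
  | Down, Down, Right, Right => 1
  | Up,   Down, Right, Left  => - y
  | _, _, _, _ => 0
  end.

Definition shifted n (P Q : strands n) : bool :=
  [forall k : 'I_n, Q (lift ord0 k) == P (widen k)].

Definition lefts n (u : 'I_n -> harrow) : nat :=
  count (fun k => u k == Left) (enum 'I_n).

Lemma shifted_admissible n (P Q : strands n) :
  [forall k : 'I_n.+1, forall l : 'I_n.+1, (val l == (val k).+1) ==>
    ([ffun k0 => Q (rev_ord k0)] k == [ffun k0 => P (rev_ord k0)] l)]
  = shifted P Q.
Proof.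
apply/forallP/forallP => /= H k.
  have Hk : (n - k.+1 < n.+1)%N by lia.
  have Hl : (n - k < n.+1)%N by lia.
  have /forallP/(_ (Ordinal Hl))/implyP := H (Ordinal Hk).
  rewrite !ffunE /=.
  have -> : rev_ord (Ordinal Hk) = lift ord0 k.
    by apply/val_inj; rewrite /= /bump /=; case: k Hk Hl => k /= *; lia.
  have -> : rev_ord (Ordinal Hl) = widen k.
    by apply/val_inj; case: k Hk Hl => k /= *; lia.
  by apply; case: k Hk Hl => k /= *; apply/eqP; lia.
apply/forallP => l; apply/implyP => /eqP Hl; rewrite !ffunE.
have Hk : (n - l < n)%N by case: l Hl => l /= *; lia.
have := H (Ordinal Hk).
have -> // : lift ord0 (Ordinal Hk) = rev_ord k.
  by apply/val_inj; rewrite /= /bump /=; case: k l Hl Hk => k ? [l ?] /= *; lia.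
have -> // : widen (Ordinal Hk) = rev_ord l.
by apply/val_inj; rewrite /=; case: k l Hl Hk => k ? [l ?] /= *; lia.
Qed.

Lemma card_rev_strands n (P : strands n) x :
  #|[set k | [ffun l => P (rev_ord l)] k == x]| = count (fun k => P k == x) (enum 'I_n.+1).
Proof.
rewrite -card_ord_count -(card_ord_rev (fun k => P k == x)).
by apply: eq_card => k; rewrite !inE ffunE.
Qed.

(** A label shared by [P] and [Q] points in on one side and out on the other,
    so only the four extreme labels count, and two of them must point in. *)
Lemma shifted_balanced n N S (P Q : strands n) : shifted P Q ->
  let v := RibbonVertex N S [ffun k => P (rev_ord k)] [ffun k => Q (rev_ord k)] in
  (arrows_in v == arrows_out v) =
  ((N == Down) + (S == Up) + (P ord_max == Right) + (Q ord0 == Left) == 2)%N.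
Proof.
move=> /forallP sh; rewrite /arrows_in /arrows_out /= !card_rev_strands.
have body x : count (fun k => P (widen k) == x) (enum 'I_n)
            = count (fun k => Q (lift ord0 k) == x) (enum 'I_n).
  by apply: eq_count => k /=; rewrite (eqP (sh k)).
rewrite 2!(count_enum_recr (fun k => P k == _)).
rewrite 2!(count_enum_recl (fun k => Q k == _)) /comp /= !body.
move: (count _ _) (count _ _) => l r.
by case: N S (P ord_max) (Q ord0) => [] [] [] [] /=; lia.
Qed.

Lemma spinE n N S (P Q : strands n) :
  spin (RibbonVertex N S [ffun k => P (rev_ord k)] [ffun k => Q (rev_ord k)])
  = lefts (fun k => Q (lift ord0 k)).
Proof.
rewrite /spin -card_ord_rev card_ord_count count_enum_recl /= subn1 ltnn /=.
apply: eq_count => k /=; rewrite ffunE rev_ordK.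
by case: (Q _ == _); rewrite ?andbF // andbT /bump /=; case: k => k /=; lia.
Qed.

(** The six types of the weight table are exactly the patterns of extreme labels
    allowed by [shifted_balanced]; in particular a shifted vertex that is not
    balanced has weight 0 in [rect_wt] as well. *)
Lemma vstrip_wtE (A : comNzRingType) (q y : A) n N S (P Q : strands n) :
  vstrip_wt q y N S P Q =
  if shifted P Q then
    rect_wt (q ^+ lefts (fun k => Q (lift ord0 k))) y N S (P ord_max) (Q ord0)
  else 0.
Proof.
rewrite /vstrip_wt /vstrip_vertex_wt /admissible /= shifted_admissible.
case: ifP => [/andP[+ sh]|]; last first.
  case: ifP => // sh; rewrite andbT shifted_balanced //.
  by case: N S (P ord_max) (Q ord0) => [] [] [] [].
rewrite sh shifted_balanced // spinE /type_of_ribbon_vertex /= !ffunE.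
have -> : rev_ord ord0 = ord_max :> 'I_n.+1 by apply: val_inj; rewrite /= subn1.
have -> : rev_ord ord_max = ord0 :> 'I_n.+1 by apply: val_inj; rewrite /= subnn.
by case: N S (P ord_max) (Q ord0) => [] [] [] [].
Qed.

(** * Weights of stacks of R1-vertices *)

Lemma prod_scale (A : comNzRingType) n (P : pred 'I_n) (c : A) :
  \prod_k (if P k then c else 1) = c ^+ count P (enum 'I_n).
Proof. by rewrite -big_mkcond prodr_const -card_ord_count cardsE. Qed.

(** The factor by which a new vertex of type [r] on top multiplies the weight of
    a stack, where [x], [nn] and [w] stand for q to the numbers of vertices of
    types N, NN and W of the stack.  Besides the weight of the new vertex, it
    contains the effect on the exponents sigma' of the N's below: each of them
    gains a factor q if [r] is SS or W. *)
Definition top_wt (A : comNzRingType) (yi yj x nn w : A)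
    (r : option R1_type) : A :=
  match r with
  | Some R1_N => nn * w * (yj - x ^+ 2 * yi)
  | Some R1_SS => x * yj
  | Some R1_W => x * yi
  | Some R1_E => yj
  | Some R1_NN => yi
  | _ => 0
  end.

(** The same for a new vertex at the bottom, which sees the SS's above it and
    acts on the N's above if it is NN, W or N. *)
Definition bottom_wt (A : comNzRingType) (yi yj x ss w : A)
    (r : option R1_type) : A :=
  match r with
  | Some R1_N => ss * w * (yj - x ^+ 2 * yi)
  | Some R1_SS => yj
  | Some R1_W => x * yi
  | Some R1_E => yj
  | Some R1_NN => x * yi
  | _ => 0
  end.

Local Notation "'#N' s" := (count_mem (Some R1_N) s) (at level 10, s at level 9).
Local Notation "'#SS' s" := (count_mem (Some R1_SS) s) (at level 10, s at level 9).
Local Notation "'#W' s" := (count_mem (Some R1_W) s) (at level 10, s at level 9).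
Local Notation "'#NN' s" := (count_mem (Some R1_NN) s) (at level 10, s at level 9).

(** Stacks are listed from top to bottom. *)
Fixpoint stack_wt (A : comNzRingType) (q yi yj : A) (s : seq (option R1_type)) :=
  if s is r :: s' then
    top_wt yi yj (q ^+ #N s') (q ^+ #NN s') (q ^+ #W s') r * stack_wt q yi yj s'
  else 1.

(** The telescoping of the factors y_j - q^(theta') y_i appears here for [r] of
    type N.  If the top vertex is an N with m other N's below it, the new bottom N
    raises its exponent theta' from 2m to 2m + 2, and the factor with exponent 2m
    that it loses is the one contributed by the rest of the stack. *)
Lemma stack_wt_rcons (A : comNzRingType) (q yi yj : A) s r :
  stack_wt q yi yj (rcons s r) =
  bottom_wt yi yj (q ^+ #N s) (q ^+ #SS s) (q ^+ #W s) r * stack_wt q yi yj s.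
Proof.
elim: s => [|t s IHs]; first by case: r => [[]|] /=; rewrite ?expr0; ring.
rewrite /= {}IHs -!cats1 !count_cat /=.
by case: t r => [[]|] [[]|] /=; rewrite ?add0n ?addn0 ?exprD ?expr1; ring.
Qed.

(** The VV weight of position [k] for types given by a function on any ['I_n].
    The induction of [prod_factor_wt] has to reach [n = 0], which R-vertices
    exclude. *)
Definition factor_wt (A : comNzRingType) (q yi yj : A) n
    (t : 'I_n -> option R1_type) (k : 'I_n) : A :=
  match t k with
  | Some R1_N =>
      q ^+ (#|[set l : 'I_n | (l < k)%N && (t l == Some R1_SS)]|
            + #|[set l : 'I_n | (k < l)%N && (t l == Some R1_NN)]|
            + #|[set l : 'I_n | t l == Some R1_W]|)
      * (yj - q ^+ (2 * #|[set l : 'I_n | (k < l)%N && (t l == Some R1_N)]|) * yi)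
  | Some R1_SS => yj
  | Some R1_W => yi
  | Some R1_E => yj
  | Some R1_NN => yi
  | _ => 0
  end.

(** Removing the top vertex changes the exponents of the remaining positions only
    through sigma', and only if it is SS or W, by 1 for each N; [stack_wt]
    collects this change in [top_wt]. *)
Lemma prod_factor_wt (A : comNzRingType) (q yi yj : A) n
    (t : 'I_n -> option R1_type) :
  \prod_k factor_wt q yi yj t k = stack_wt q yi yj [seq t k | k <- enum 'I_n].
Proof.
elim: n t => [|n IHn] t; first by rewrite big_ord0 enum_ord0.
rewrite big_ord_recl enum_ordSl /= -map_comp -IHn.
set u := t \o lift ord0.
have count_u c : count_mem c [seq u k | k <- enum 'I_n]
               = count (fun k => t (lift ord0 k) == c) (enum 'I_n).
  by rewrite count_map.
(* The contribution of the top vertex to each sigma' below it. *)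
pose e := ((t ord0 == Some R1_SS) + (t ord0 == Some R1_W))%N.
have -> : \prod_k factor_wt q yi yj t (lift ord0 k)
   = q ^+ (e * #N [seq u k | k <- enum 'I_n]) * \prod_k factor_wt q yi yj u k.
  rewrite exprM count_map -prod_scale -big_split; apply: eq_bigr => k _ /=.
  rewrite /factor_wt /u /=.
  case: (t (lift ord0 k)) => [[]|]; rewrite ?mul1r //.
  rewrite eqxx !card_ord_count !count_enum_recl /= !add0n mulrA -exprD.
  by rewrite -(addnA (t ord0 == _ : nat)) addnACA.
rewrite mulrA; congr (_ * _).
rewrite /factor_wt {}/e !count_u.
have gt0 (c : R1_type) : #|[set l : 'I_n.+1 | (0 < l)%N && (t l == Some c)]|
    = count (fun k => t (lift ord0 k) == Some c) (enum 'I_n).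
  by rewrite card_ord_count count_enum_recl.
have lt0 (c : R1_type) : #|[set l : 'I_n.+1 | (l < 0)%N && (t l == Some c)]| = 0%N.
  by rewrite card_ord_count count_pred0.
rewrite /= !gt0 (lt0 R1_SS) card_ord_count count_enum_recl /comp /=.
case: (t ord0) => [[]|]; rewrite /= ?mul0r ?mul1n ?mul0n ?expr0 ?mulr1 //.
- by rewrite !add0n mulnC exprM exprD.
- exact: mulrC.
- exact: mulrC.
Qed.

Lemma VV_wtE (A : comNzRingType) (q yi yj : A) n (v : R_vertex n) :
  VV_wt q yi yj v = stack_wt q yi yj [seq R1_at v k | k <- enum 'I_n.+1].
Proof. by rewrite -prod_factor_wt. Qed.

Definition nonzero_type (r : option R1_type) : bool :=
  if r is Some r' then r' != R1_S else false.

Lemma stack_wt_eq0 (A : comNzRingType) (q yi yj : A) s :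
  ~~ all nonzero_type s -> stack_wt q yi yj s = 0.
Proof.
elim: s => //= r s IHs; rewrite negb_and => /orP[|/IHs ->]; last exact: mulr0.
by case: r => [[]|] //= _; rewrite mul0r.
Qed.

(** The left arrows on each side of a stack are counted by types; type S, which
    would enter the counts for [i] and [k], is excluded by its weight 0. *)
Lemma count_left (T : Type) (i j k l : T -> harrow) (e : seq T) :
  let s := [seq type_of_R1 (i x) (j x) (k x) (l x) | x <- e] in
  all nonzero_type s ->
  [/\ count (fun x => i x == Left) e = (#W s + #NN s)%N,
      count (fun x => j x == Left) e = (#N s + #SS s + #W s)%N,
      count (fun x => k x == Left) e = (#SS s + #W s)%N
    & count (fun x => l x == Left) e = (#N s + #W s + #NN s)%N].
Proof.
elim: e => //= x e IHe /andP[hx /IHe[-> -> -> ->]].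
by case: (i x) (j x) (k x) (l x) hx => [] [] [] [] //= _; split; lia.
Qed.

(** * Summing over shifted labels *)

(** The western labels of a shifted row with eastern labels [Q] and bottom western
    label [x]. *)
Definition west_of n (Q : strands n) (x : harrow) : strands n :=
  [ffun k => if unlift ord_max k is Some l then Q (lift ord0 l) else x].

Definition east_of n (P : strands n) (x : harrow) : strands n :=
  [ffun k => if unlift ord0 k is Some l then P (widen l) else x].

Lemma widenE n (k : 'I_n) : widen k = lift ord_max k.
Proof. by apply/val_inj/esym/lift_max. Qed.

Lemma west_of_widen n (Q : strands n) x k : west_of Q x (widen k) = Q (lift ord0 k).
Proof. by rewrite ffunE widenE liftK. Qed.

Lemma west_of_max n (Q : strands n) x : west_of Q x ord_max = x.
Proof. by rewrite ffunE unlift_none. Qed.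

Lemma east_of_lift n (P : strands n) x k : east_of P x (lift ord0 k) = P (widen k).
Proof. by rewrite ffunE liftK. Qed.

Lemma east_of0 n (P : strands n) x : east_of P x ord0 = x.
Proof. by rewrite ffunE unlift_none. Qed.

Lemma sum_shifted_west (V : nmodType) n (Q : strands n) (F : strands n -> V) :
  \sum_P (if shifted P Q then F P else 0) = \sum_x F (west_of Q x).
Proof.
rewrite -big_mkcond (reindex_onto (west_of Q) (fun P : strands n => P ord_max)).
  apply: eq_bigl => x; rewrite west_of_max eqxx andbT.
  by apply/forallP => k; rewrite west_of_widen.
move=> P /forallP sh; apply/ffunP => k; rewrite ffunE.
by case: unliftP => [l|] -> //; rewrite (eqP (sh l)) widenE.
Qed.

Lemma sum_shifted_east (V : nmodType) n (P : strands n) (F : strands n -> V) :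
  \sum_Q (if shifted P Q then F Q else 0) = \sum_x F (east_of P x).
Proof.
rewrite -big_mkcond (reindex_onto (east_of P) (fun Q : strands n => Q ord0)).
  apply: eq_bigl => x; rewrite east_of0 eqxx andbT.
  by apply/forallP => k; rewrite east_of_lift.
move=> Q /forallP sh; apply/ffunP => k; rewrite ffunE.
by case: unliftP => [l|] -> //; rewrite (eqP (sh l)).
Qed.

Lemma sum_shifted_west2 (V : nmodType) n (Q Q' : strands n)
    (F : strands n -> strands n -> V) :
  \sum_P \sum_P' (if shifted P Q && shifted P' Q' then F P P' else 0)
  = \sum_x \sum_y F (west_of Q x) (west_of Q' y).
Proof.
rewrite -(sum_shifted_west Q (fun P => \sum_y F P (west_of Q' y))).
apply: eq_bigr => P _; case: ifP => _ /=; last exact: big1.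
by rewrite sum_shifted_west.
Qed.

Lemma sum_shifted_east2 (V : nmodType) n (P P' : strands n)
    (F : strands n -> strands n -> V) :
  \sum_Q \sum_Q' (if shifted P Q && shifted P' Q' then F Q Q' else 0)
  = \sum_x \sum_y F (east_of P x) (east_of P' y).
Proof.
rewrite -(sum_shifted_east P (fun Q => \sum_y F Q (east_of P' y))).
apply: eq_bigr => Q _; case: ifP => _ /=; last exact: big1.
by rewrite sum_shifted_east.
Qed.

(** * The Yang-Baxter equation *)

(** The R1-vertices common to both sides: the outer labels of the eastern sides
    without the top strand and of the western sides without the bottom one. *)
Definition middle_stack n (b c beta gamma : strands n) : seq (option R1_type) :=
  [seq type_of_R1 (gamma (lift ord0 k)) (beta (lift ord0 k))
                  (c (widen k)) (b (widen k)) | k <- enum 'I_n].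

Lemma YBE_left_sum (A : comNzRingType) (q yi yj : A) n
    (a alpha : varrow) (b c beta gamma : strands n) :
  \sum_(I : strands n) \sum_(J : strands n) \sum_(delta : varrow)
     VV_wt q yi yj (RVertex I J c b)
     * vstrip_wt q yi a delta I gamma * vstrip_wt q yj delta alpha J beta
  = \sum_x \sum_y \sum_delta
    stack_wt q yi yj (rcons (middle_stack b c beta gamma)
                            (type_of_R1 x y (c ord_max) (b ord_max)))
    * rect_wt (q ^+ lefts (gamma \o lift ord0)) yi a delta x (gamma ord0)
    * rect_wt (q ^+ lefts (beta \o lift ord0)) yj delta alpha y (beta ord0).
Proof.
pose F (I J : strands n) := \sum_delta VV_wt q yi yj (RVertex I J c b)
  * rect_wt (q ^+ lefts (gamma \o lift ord0)) yi a delta (I ord_max) (gamma ord0)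
  * rect_wt (q ^+ lefts (beta \o lift ord0)) yj delta alpha (J ord_max) (beta ord0).
transitivity (\sum_I \sum_J
    (if shifted I gamma && shifted J beta then F I J else 0)).
  apply: eq_bigr => I _; apply: eq_bigr => J _.
  case: ifP => [/andP[sI sJ]|/negbT]; last rewrite negb_and => /orP sh.
    by apply: eq_bigr => d _; rewrite !vstrip_wtE sI sJ.
  apply: big1 => d _; rewrite !vstrip_wtE.
  by case: sh => /negbTE ->; rewrite !(mulr0, mul0r).
rewrite sum_shifted_west2; apply: eq_bigr => x _; apply: eq_bigr => y _.
apply: eq_bigr => d _; rewrite !west_of_max VV_wtE enum_ordSr map_rcons -map_comp.
congr (stack_wt _ _ _ (rcons _ _) * _ * _); last first.
  by rewrite /R1_at /= !west_of_max.
by apply: eq_map => k; rewrite /R1_at /= !west_of_widen.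
Qed.

Lemma YBE_right_sum (A : comNzRingType) (q yi yj : A) n
    (a alpha : varrow) (b c beta gamma : strands n) :
  \sum_(K : strands n) \sum_(L : strands n) \sum_(xi : varrow)
     vstrip_wt q yj a xi b L * vstrip_wt q yi xi alpha c K
     * VV_wt q yi yj (RVertex gamma beta K L)
  = \sum_x \sum_y \sum_xi
    rect_wt (q ^+ lefts (b \o widen)) yj a xi (b ord_max) y
    * rect_wt (q ^+ lefts (c \o widen)) yi xi alpha (c ord_max) x
    * stack_wt q yi yj (type_of_R1 (gamma ord0) (beta ord0) x y
                        :: middle_stack b c beta gamma).
Proof.
pose F (K L : strands n) := \sum_xi
  rect_wt (q ^+ lefts (L \o lift ord0)) yj a xi (b ord_max) (L ord0)
  * rect_wt (q ^+ lefts (K \o lift ord0)) yi xi alpha (c ord_max) (K ord0)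
  * VV_wt q yi yj (RVertex gamma beta K L).
transitivity (\sum_K \sum_L
    (if shifted c K && shifted b L then F K L else 0)).
  apply: eq_bigr => K _; apply: eq_bigr => L _.
  case: ifP => [/andP[sK sL]|/negbT]; last rewrite negb_and => /orP sh.
    by apply: eq_bigr => d _; rewrite !vstrip_wtE sK sL.
  apply: big1 => d _; rewrite !vstrip_wtE.
  by case: sh => /negbTE ->; rewrite !(mulr0, mul0r).
rewrite sum_shifted_east2; apply: eq_bigr => x _; apply: eq_bigr => y _.
apply: eq_bigr => d _; rewrite !east_of0 VV_wtE enum_ordSl map_cons -map_comp.
congr (rect_wt (q ^+ _) _ _ _ _ _ * rect_wt (q ^+ _) _ _ _ _ _
       * stack_wt _ _ _ (_ :: _)).
- by apply: eq_count => k /=; rewrite east_of_lift.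
- by apply: eq_count => k /=; rewrite east_of_lift.
- by rewrite /R1_at /= !east_of0.
- by apply: eq_map => k; rewrite /R1_at /= !east_of_lift.
Qed.

(** The stack [M] enters only through its weight [m] and through q to its type
    counts, which may be arbitrary ring elements; the equation thus becomes one
    polynomial identity for each choice of the six outer labels. *)
Lemma one_strand_YBE (A : comNzRingType) (yi yj x nn ss w m : A)
    (a alpha : varrow) (b c beta gamma : harrow) :
  \sum_i \sum_j \sum_delta
    bottom_wt yi yj x ss w (type_of_R1 i j c b) * m *
    rect_wt (w * nn) yi a delta i gamma *
    rect_wt (x * ss * w) yj delta alpha j beta
  = \sum_k \sum_l \sum_xi
    rect_wt (x * w * nn) yj a xi b l *
    rect_wt (ss * w) yi xi alpha c k *
    (top_wt yi yj x nn w (type_of_R1 gamma beta k l) * m).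
Proof.
rewrite !(big_harrow, big_varrow).
by case: a alpha b c beta gamma => [] [] [] [] [] []; rewrite /=; ring.
Qed.

Theorem theorem5p2 (A : comNzRingType) (q yi yj : A) (n : nat)
    (a alpha : varrow) (b c beta gamma : strands n) :
  \sum_(I : strands n) \sum_(J : strands n) \sum_(delta : varrow)
     VV_wt q yi yj (RVertex I J c b)
     * vstrip_wt q yi a delta I gamma
     * vstrip_wt q yj delta alpha J beta
  =
  \sum_(K : strands n) \sum_(L : strands n) \sum_(xi : varrow)
     vstrip_wt q yj a xi b L
     * vstrip_wt q yi xi alpha c K
     * VV_wt q yi yj (RVertex gamma beta K L).
Proof.
rewrite YBE_left_sum YBE_right_sum; set M := middle_stack b c beta gamma.
have [okM|/(stack_wt_eq0 q yi yj) M0] := boolP (all nonzero_type M); last first.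
  rewrite !big1 // => x _; apply: big1 => y _; apply: big1 => d _.
    by rewrite /= M0 !mulr0.
  by rewrite stack_wt_rcons M0 mulr0 !mul0r.
have [lgamma lbeta lc lb] := count_left okM.
rewrite /lefts lgamma lbeta lc lb !exprD.
under eq_bigr => x _ do under eq_bigr => y _ do
  under eq_bigr => d _ do rewrite stack_wt_rcons.
exact: one_strand_YBE.
Qed.
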